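(* Let $G$ and $H$ be finite groups acting on each other (and on themselves by conjugation). If the mutual actions are compatible, then the nonabelian tensor product $G\otimes H$ is finite.
   Context: All actions are left actions by automorphisms. $G$ acts on $H$ and $H$ acts on $G$, and each group acts on itself by conjugation, ${}^{g}g'=gg'g^{-1}$, ${}^{h}h'=hh'h^{-1}$; ${}^{a}b$ denotes the result of acting by $a$ on $b$. The mutual actions are compatible if ${}^{({}^{h}g)}h'={}^{h}\big({}^{g}({}^{h^{-1}}h')\big)$ and ${}^{({}^{g}h)}g'={}^{g}\big({}^{h}({}^{g^{-1}}g')\big)$ for all $g,g'\in G$, $h,h'\in H$. The nonabelian tensor product $G\otimes H$ is the group generated by the symbols $g\otimes h$ ($g\in G$, $h\in H$) subject to the relations $gg'\otimes h=({}^{g}g'\otimes {}^{g}h)(g\otimes h)$ and $g\otimes hh'=(g\otimes h)({}^{h}g\otimes {}^{h}h')$ for all $g,g'\in G$, $h,h'\in H$. *)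

(* Defs.v *)
From HB Require Import structures.
From mathcomp Require Import all_boot all_fingroup.
From mathcomp Require Import boolp classical_sets functions cardinality.

Set Implicit Arguments.
Unset Strict Implicit.
Unset Printing Implicit Defensive.

Local Open Scope group_scope.
Local Open Scope quotient_scope.

(* Groups given by generators and relations: a letter (x, false) stands for
   the generator x and (x, true) for its inverse; relator u v is the relation
   "u = v". *)
Section Presentation.
Variable X : choiceType.

Definition word : Type := seq (X * bool).

Definition inv_letter (l : X * bool) : X * bool := (l.1, ~~ l.2).
Definition inv_word (u : word) : word := rev (map inv_letter u).

Variable relator : word -> word -> Prop.

Inductive word_equiv : word -> word -> Prop :=
| word_equiv_refl u : word_equiv u u
| word_equiv_sym u v : word_equiv u v -> word_equiv v u
| word_equiv_trans u v w : word_equiv u v -> word_equiv v w -> word_equiv u w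
| word_equiv_cat u u' v v' :
    word_equiv u u' -> word_equiv v v' -> word_equiv (u ++ v) (u' ++ v')
| word_equiv_cancel l : word_equiv [:: l; inv_letter l] [::]
| word_equiv_rel u v : relator u v -> word_equiv u v.

Definition word_equivb : rel word := fun u v => `[< word_equiv u v >].

Lemma word_equivb_refl : reflexive word_equivb.
Proof. by move=> u; apply/asboolP/word_equiv_refl. Qed.

Lemma word_equivb_sym : symmetric word_equivb.
Proof. by move=> u v; apply/asboolP/asboolP; apply: word_equiv_sym. Qed.

Lemma word_equivb_trans : transitive word_equivb.
Proof.
by move=> v u w /asboolP uv /asboolP vw; apply/asboolP/(word_equiv_trans uv vw).
Qed.

Canonical word_equivb_equiv :=
  EquivRel word_equivb word_equivb_refl word_equivb_sym word_equivb_trans.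

Definition presented_group : Type := {eq_quot word_equivb}.
HB.instance Definition _ := Choice.on presented_group.

Definition word_class (u : word) : presented_group := \pi_{eq_quot word_equivb} u.
Definition word_repr (x : presented_group) : word :=
  generic_quotient.repr (x : {eq_quot word_equivb}).

Lemma word_reprK : cancel word_repr word_class.
Proof. exact: reprK. Qed.

Lemma word_classP u v : word_class u = word_class v <-> word_equiv u v.
Proof.
split=> [/eqmodP/asboolP//|uv].
by apply/eqmodP/asboolP.
Qed.

Lemma word_equiv_repr u : word_equiv (word_repr (word_class u)) u.
Proof. by apply/word_classP; rewrite word_reprK. Qed.

Lemma inv_letterK : involutive inv_letter.
Proof. by case=> x b; rewrite /inv_letter /= negbK. Qed.

Lemma inv_wordK : involutive inv_word.
Proof.
by move=> u; rewrite /inv_word map_rev revK -map_comp map_id_in// => l _ /=;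
   rewrite inv_letterK.
Qed.

Lemma word_equiv_mulV u : word_equiv (u ++ inv_word u) [::].
Proof.
elim: u => [|l u IHu]; first exact: word_equiv_refl.
have -> : (l :: u) ++ inv_word (l :: u) =
    [:: l] ++ (u ++ inv_word u) ++ [:: inv_letter l].
  by rewrite /inv_word /= rev_cons -cats1 -catA.
apply: (word_equiv_trans _ (word_equiv_cancel l)).
apply: (word_equiv_cat (word_equiv_refl [:: l])).
exact: (word_equiv_cat IHu (word_equiv_refl _)).
Qed.

Lemma word_equiv_Vmul u : word_equiv (inv_word u ++ u) [::].
Proof. by have := word_equiv_mulV (inv_word u); rewrite inv_wordK. Qed.

Lemma word_equiv_inv u v :
  word_equiv u v -> word_equiv (inv_word u) (inv_word v).
Proof.
move=> uv; have r := word_equiv_refl.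
apply: (@word_equiv_trans _ (inv_word u ++ v ++ inv_word v)).
  rewrite -[X in word_equiv X _]cats0; apply: word_equiv_cat => //.
  exact/word_equiv_sym/word_equiv_mulV.
rewrite catA -[X in word_equiv _ X]cat0s; apply: word_equiv_cat => //.
apply: word_equiv_trans (word_equiv_Vmul u).
by apply: word_equiv_cat => //; apply: word_equiv_sym.
Qed.

Definition presented_one : presented_group := word_class [::].
Definition presented_mul (x y : presented_group) : presented_group :=
  word_class (word_repr x ++ word_repr y).
Definition presented_inv (x : presented_group) : presented_group :=
  word_class (inv_word (word_repr x)).

Lemma presented_mulE u v :
  presented_mul (word_class u) (word_class v) = word_class (u ++ v).
Proof. by apply/word_classP/word_equiv_cat; apply: word_equiv_repr. Qed.

Lemma presented_invE u : presented_inv (word_class u) = word_class (inv_word u).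
Proof. by apply/word_classP/word_equiv_inv/word_equiv_repr. Qed.

Lemma presented_mulA : associative presented_mul.
Proof.
move=> x y z; rewrite -(word_reprK x) -(word_reprK y) -(word_reprK z).
by rewrite !presented_mulE catA.
Qed.

Lemma presented_mul1 : left_id presented_one presented_mul.
Proof. by move=> x; rewrite -(word_reprK x) presented_mulE. Qed.

Lemma presented_mulr1 : right_id presented_one presented_mul.
Proof. by move=> x; rewrite -(word_reprK x) presented_mulE cats0. Qed.

Lemma presented_mulV : left_inverse presented_one presented_inv presented_mul.
Proof.
move=> x; rewrite -(word_reprK x) presented_invE presented_mulE.
exact/word_classP/word_equiv_Vmul.
Qed.

Lemma presented_mulrV : right_inverse presented_one presented_inv presented_mul.
Proof.
move=> x; rewrite -(word_reprK x) presented_invE presented_mulE.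
exact/word_classP/word_equiv_mulV.
Qed.

HB.instance Definition _ := isGroup.Build presented_group
  presented_mulA presented_mul1 presented_mulr1 presented_mulV presented_mulrV.

End Presentation.

Section NonabelianTensor.

Definition lconj (G : groupType) (x y : G) : G := x * y * x^-1.

(* Left action of G on the group H by automorphisms; bijectivity of act g
   follows from the first two fields. MathComp's action and groupAction are
   right actions. *)
Record left_aut_action (G H : groupType) (act : G -> H -> H) : Prop :=
  LeftAutAction {
    left_act1 : forall h, act 1 h = h;
    left_actM : forall g g' h, act (g * g') h = act g (act g' h);
    left_act_mul : forall g h h', act g (h * h') = act g h * act g h' }.

Definition compatible_actions (G H : groupType)
    (aGH : G -> H -> H) (aHG : H -> G -> G) : Prop :=
  (forall g h h', aGH (aHG h g) h' = lconj h (aGH g (lconj h^-1 h'))) /\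
  (forall g g' h, aHG (aGH g h) g' = lconj g (aHG h (lconj g^-1 g'))).

Variables (G H : groupType) (aGH : G -> H -> H) (aHG : H -> G -> G).

Let symb (g : G) (h : H) : (G * H) * bool := ((g, h), false).

Inductive tensor_rel : word (G * H)%type -> word (G * H)%type -> Prop :=
| tensor_relMl g g' h :
    tensor_rel [:: symb (g * g') h]
               [:: symb (lconj g g') (aGH g h); symb g h]
| tensor_relMr g h h' :
    tensor_rel [:: symb g (h * h')]
               [:: symb g h; symb (aHG h g) (lconj h h')].

Definition nonabelian_tensor : Type := presented_group tensor_rel.
HB.instance Definition _ := Group.on nonabelian_tensor.

Definition tensor (g : G) (h : H) : nonabelian_tensor :=
  word_class tensor_rel [:: symb g h].

Lemma tensorMl g g' h :
  tensor (g * g') h = tensor (lconj g g') (aGH g h) * tensor g h.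
Proof.
rewrite -[RHS]/(presented_mul _ _) presented_mulE.
exact/word_classP/word_equiv_rel/tensor_relMl.
Qed.

Lemma tensorMr g h h' :
  tensor g (h * h') = tensor g h * tensor (aHG h g) (lconj h h').
Proof.
rewrite -[RHS]/(presented_mul _ _) presented_mulE.
exact/word_classP/word_equiv_rel/tensor_relMr.
Qed.

Lemma tensor_lift (L : groupType) (f : G -> H -> L) :
    (forall g g' h, f (g * g') h = f (lconj g g') (aGH g h) * f g h) ->
    (forall g h h', f g (h * h') = f g h * f (aHG h g) (lconj h h')) ->
  exists! phi : nonabelian_tensor -> L,
    {morph phi : x y / x * y} /\ forall g h, phi (tensor g h) = f g h.
Proof.
move=> fMl fMr.
pose ev (l : (G * H) * bool) : L :=
  if l.2 then (f l.1.1 l.1.2)^-1 else f l.1.1 l.1.2.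
pose evw (u : word (G * H)%type) : L := \prod_(l <- u) ev l.
have ev_inv l : ev (inv_letter l) = (ev l)^-1.
  by case: l => [x []]; rewrite /ev /= ?invgK.
have evE u v : word_equiv tensor_rel u v -> evw u = evw v.
  elim=> {u v} //=.
  - by move=> u v w _ -> _ ->.
  - move=> u u' v v' _ eu _ ev'; rewrite /evw !big_cat /= -/(evw _) eu -/(evw _).
    by rewrite ev'.
  - by move=> l; rewrite /evw !big_cons !big_nil ev_inv mulg1 mulgV.
  - have ev1 l : evw [:: l] = ev l by rewrite /evw big_seq1.
    have ev2 l l' : evw [:: l; l'] = ev l * ev l'.
      by rewrite /evw big_cons big_seq1.
    move=> u v [g g' h|g h h']; rewrite ev1 ev2.
      exact: fMl.
    exact: fMr.
exists (fun x => evw (word_repr x)); split.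
  split=> [x y|g h].
    rewrite (evE _ _ (word_equiv_repr _ _)); exact: big_cat.
  rewrite (evE _ _ (word_equiv_repr _ _)) /evw big_cons big_nil mulg1 //.
move=> psi [psiM psiE].
have psi1 : psi 1 = 1.
  by apply: (mulgI (psi 1)); rewrite -psiM !mulg1.
apply/funext => x.
rewrite -[in RHS](word_reprK x); elim: (word_repr x) => [|l u IHu].
  by rewrite /evw big_nil; exact/esym/psi1.
rewrite -cat1s -presented_mulE [RHS]psiM /evw big_cons -/(evw u).
rewrite -IHu; congr (_ * _).
case: l => [[g h] []]; rewrite /ev /= -psiE //.
apply: (mulgI (psi (tensor g h))); rewrite mulgV -psiM -[LHS]psi1; congr psi.
by apply/esym; rewrite -[LHS]/(presented_mul _ _) presented_mulE;
   apply/word_classP/(word_equiv_cancel _ ((g,h),false)).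
Qed.

End NonabelianTensor.

(* Main.v *)
(* The map [lam : g ⊗ h |-> g * (^h g)^-1] is a morphism to [G], and
   conjugation by [t] acts on the symbols [g ⊗ h] through the diagonal action
   of [lam t].  So the symbols form a finite set stable under conjugation, and
   the kernel of [lam] is central.  Every abelian image of [G ⊗ H] has exponent
   dividing [#|G| * #|H|]; composing with the transfer to the centre, which is
   a power map on the kernel of [lam], each symbol has finite order.
   Dietzmann's lemma then gives finiteness. *)
From HB Require Import structures.
Require Import Defs.
From mathcomp Require Import all_boot all_fingroup.
From mathcomp Require Import boolp classical_sets functions cardinality.
From mathcomp Require Import ssralg.

Set Implicit Arguments.
Unset Strict Implicit.
Unset Printing Implicit Defensive.

Import GRing.Theory.
Local Open Scope group_scope.

(** * The centre as an abelian group *)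

Section Centre.
Variable T : groupType.

Definition centralb (z : T) : bool := `[< forall x : T, z * x = x * z >].

Lemma centralP (z : T) : reflect (forall x : T, z * x = x * z) (centralb z).
Proof. exact: asboolP. Qed.

Lemma central1 : centralb 1.
Proof. by apply/centralP => x; rewrite mul1g mulg1. Qed.

Lemma centralM (y z : T) : centralb y -> centralb z -> centralb (y * z).
Proof.
by move=> /centralP cy /centralP cz; apply/centralP => x;
   rewrite -mulgA cz !mulgA cy.
Qed.

Lemma centralV (z : T) : centralb z -> centralb z^-1.
Proof.
move=> /centralP cz; apply/centralP => x.
by apply: (mulgI z); rewrite mulKVg mulgA cz mulgK.
Qed.

(** Written additively, as a [zmodType], so that the transfer is a finite sum and counts as an
    abelian image. *)
Definition centre : Type := {z : T | centralb z}.
HB.instance Definition _ := SubChoice.on centre.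

Definition centre_add (y z : centre) : centre :=
  exist _ (val y * val z) (centralM (valP y) (valP z)).
Definition centre_opp (z : centre) : centre :=
  exist _ (val z)^-1 (centralV (valP z)).
Definition centre_zero : centre := exist _ 1 central1.

Lemma centre_addA : associative centre_add.
Proof. by move=> x y z; apply/val_inj; rewrite /= mulgA. Qed.
Lemma centre_addC : commutative centre_add.
Proof. by move=> y z; apply/val_inj/centralP/(valP y). Qed.
Lemma centre_add0 : left_id centre_zero centre_add.
Proof. by move=> z; apply/val_inj; rewrite /= mul1g. Qed.
Lemma centre_addN : left_inverse centre_zero centre_opp centre_add.
Proof. by move=> z; apply/val_inj; rewrite /= mulVg. Qed.

HB.instance Definition _ := GRing.isZmodule.Build centre
  centre_addA centre_addC centre_add0 centre_addN.

Lemma val_centreMn (z : centre) n : val (z *+ n)%R = val z ^+ n.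
Proof. by elim: n => // n IHn; rewrite mulrS expgS -IHn. Qed.

End Centre.

Section GroupMorphisms.
Variables (T U : groupType) (f : T -> U).
Hypothesis fM : {morph f : x y / x * y}.

Lemma morph_one : f 1 = 1.
Proof. by apply: (mulgI (f 1)); rewrite -fM !mulg1. Qed.

Lemma morph_inv x : f x^-1 = (f x)^-1.
Proof. by apply: (mulgI (f x)); rewrite -fM !mulgV morph_one. Qed.

Lemma morph_exp x n : f (x ^+ n) = f x ^+ n.
Proof. by elim: n => [|n IHn]; rewrite ?morph_one // !expgS fM IHn. Qed.

End GroupMorphisms.

(** * Transfer to the centre *)

Section Transfer.
Variables (T : groupType) (Q : finGroupType) (lam : T -> Q).
Hypothesis lamM : {morph lam : x y / x * y}.
Hypothesis ker_central : forall z, lam z = 1 -> forall x, z * x = x * z.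

Let im_lam : {set Q} := [set q | `[< exists t, lam t = q >]].

(** With [s] a section of [lam] over its image, each factor [w t q] lies in the kernel of [lam],
    hence is central; the transfer sums these factors over the image. For [z] in the kernel each
    factor is [z] itself, so [n] is the order of the image. *)
Lemma transfer_exists : exists V : T -> centre T,
  (forall x y, V (x * y) = (V x + V y)%R) /\
  exists2 n, 0 < n & forall z, lam z = 1 -> val (V z) = z ^+ n.
Proof.
have /choice [s sK] : forall q, exists t : T, q \in im_lam -> lam t = q.
  move=> q; case: (boolP (q \in im_lam)); last by exists 1.
  by rewrite inE => /asboolP[t <-]; exists t.
have imM t q : (lam t * q \in im_lam) = (q \in im_lam).
  rewrite !inE; apply/asboolP/asboolP => -[u uE].
    by exists (t^-1 * u); rewrite lamM uE morph_inv // mulKg.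
  by exists (t * u); rewrite lamM uE.
pose w t q := (s (lam t * q))^-1 * t * s q.
have wker t q : q \in im_lam -> centralb (w t q).
  move=> qi; apply/centralP/ker_central.
  by rewrite /w !lamM morph_inv // !sK ?imM // -mulgA mulVg.
(* The default [0] can occur only for [q] outside the image, and such [q] are never summed. *)
pose v t q : centre T := insubd (0%R : centre T) (w t q).
have vE t q : q \in im_lam -> val (v t q) = w t q.
  by move=> qi; rewrite /v val_insubd wker.
exists (fun t => \sum_(q in im_lam) v t q)%R; split=> [x y|].
  (* Translation by [lam y] permutes the image; afterwards [w x (lam y * q) * w y q] telescopes to
     [w (x * y) q]. *)
  have -> : (\sum_(q in im_lam) v x q = \sum_(q in im_lam) v x (lam y * q)%g)%R.
    rewrite (reindex_inj (mulgI (lam y))) /=.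
    by apply: eq_bigl => q; rewrite imM.
  rewrite -big_split /=; apply: eq_bigr => q qi; apply/val_inj => /=.
  by rewrite !vE ?imM // /w lamM !mulgA mulgK.
exists #|im_lam|.
  apply/card_gt0P; exists 1; rewrite inE; apply/asboolP.
  by exists 1; apply: morph_one.
move=> z lz; have cz := ker_central lz.
have zc : centralb z by apply/centralP.
rewrite (eq_bigr (fun=> (exist _ z zc : centre T))) => [|q qi].
  by rewrite sumr_const val_centreMn.
by apply/val_inj; rewrite vE //= /w lz mul1g -mulgA cz mulKg.
Qed.

(** The power [t ^+ #[lam t]] lies in the kernel of [lam], where the transfer [V] is the [n]-th
    power map, while [m] kills [V t]. *)
Lemma torsion_of_abelian_images (t : T) m : 0 < m ->
    (forall (A : zmodType) (f : T -> A),
       (forall x y, f (x * y) = (f x + f y)%R) -> (f t *+ m = 0)%R) ->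
  exists2 n, 0 < n & t ^+ n = 1.
Proof.
move=> m_gt0 tm; have [V [VM [n n_gt0 VE]]] := transfer_exists.
have V0 : V 1 = 0%R by apply: (addrI (V 1)); rewrite -VM mulg1 addr0.
have VX k : V (t ^+ k) = (V t *+ k)%R.
  by elim: k => // k IHk; rewrite expgS VM IHk mulrS.
exists (#[lam t] * m * n)%N; first by rewrite !muln_gt0 order_gt0 m_gt0 n_gt0.
rewrite expgM -VE ?VX; last by rewrite morph_exp // expgM expg_order expg1n.
by rewrite mulnC mulrnA tm // mul0rn.
Qed.

End Transfer.

Lemma prodg_nseq (T : groupType) (X : Type) (f : X -> T) k a :
  \prod_(x <- nseq k a) f x = f a ^+ k.
Proof. by elim: k => [|k IHk]; rewrite ?big_nil //= big_cons IHk expgS. Qed.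

(* Dietzmann's lemma: in a long product some generator [a] occurs often, and
   collecting its occurrences on the left cancels them, at the cost of
   replacing the other factors by conjugates. *)
Section Dietzmann.
Variables (T : groupType) (X : finType) (f : X -> T).
Hypothesis f_conj : forall a b, exists c, f b * f a = f a * f c.
Hypothesis f_gen : forall t, exists s : seq X, t = \prod_(x <- s) f x.

Lemma collect a (s : seq X) : exists2 s' : seq X,
  (size s' + count_mem a s = size s)%N &
  \prod_(x <- s) f x = f a ^+ count_mem a s * \prod_(x <- s') f x.
Proof.
have conjX k b : exists c, f b * f a ^+ k = f a ^+ k * f c.
  elim: k => [|k [c IHk]]; first by exists b; rewrite mul1g mulg1.
  have [d cd] := f_conj a c; exists d.
  by rewrite expgSr mulgA IHk -!mulgA cd.
elim: s => [|b s [s' sz IHs]]; first by exists [::]; rewrite ?big_nil ?mulg1.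
rewrite big_cons IHs /=; case: eqVneq => [->|_].
  by exists s'; rewrite ?add1n ?addnS ?sz // expgS mulgA.
have [c bc] := conjX (count_mem a s) b.
by exists (c :: s'); rewrite /= ?add0n ?addSn ?sz // big_cons !mulgA bc.
Qed.

Lemma dietzmann N : 0 < N -> (forall x, f x ^+ N = 1) ->
  finite_set [set: T]%classic.
Proof.
move=> N_gt0 fN; pose K := (#|X| * N)%N.
have short t : exists2 s : seq X, size s <= K & t = \prod_(x <- s) f x.
  have [s ->] := f_gen t; have [n] := ubnP (size s).
  elim: n s => // n IHn s; rewrite ltnS => sn.
  have [|Ks] := leqP (size s) K; first by exists s.
  (* Pigeonhole: if every letter occurred fewer than [N] times, the length would be at most
     [#|X| * N]. *)
  have [a Na] : exists a, N <= count_mem a s.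
    apply/existsP; apply: contraTT Ks => /existsPn Ns.
    rewrite -leqNgt -(sum1_size s) /K.
    rewrite (partition_big id predT) //= -sum_nat_const.
    apply: leq_sum => a _; rewrite sum1_count.
    by rewrite ltnW // ltnNge Ns.
  have [s' sz ->] := collect a s.
  (* Exactly [N] copies of [a] are cancelled and the others put back, so the word gets shorter by
     [N]. *)
  have -> : f a ^+ count_mem a s * \prod_(x <- s') f x =
      \prod_(x <- nseq (count_mem a s - N) a ++ s') f x.
    rewrite big_cat /= -{1}(subnKC Na) expgD fN mul1g.
    by rewrite prodg_nseq.
  apply: IHn; rewrite size_cat size_nseq; apply: leq_trans sn.
  by rewrite -sz addnC ltn_add2l ltn_subrL N_gt0 (leq_trans N_gt0).
(* The words of length at most [K] form a finite type, and their values exhaust [T]. *)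
pose ev (u : {k : 'I_K.+1 & k.-tuple X}) : T := \prod_(x <- tagged u) f x.
apply: (@sub_finite_set _ _ (ev @` [set: _])%classic).
  move=> t _; have [s sK ->] := short t.
  have sK' : size s < K.+1 by [].
  by exists (Tagged (fun k : 'I_K.+1 => k.-tuple X)
    (in_tuple s : (Ordinal sK').-tuple X)).
exact/finite_image/finite_finset.
Qed.

End Dietzmann.

(** * Conjugation and left actions by automorphisms *)

Section LeftConjugation.
Variable K : groupType.
Implicit Types x y z : K.

Lemma lconjM x y z : lconj (x * y) z = lconj x (lconj y z).
Proof. by rewrite /lconj invgM !mulgA. Qed.

Lemma lconj1 x : lconj 1 x = x.
Proof. by rewrite /lconj mul1g invg1 mulg1. Qed.

Lemma lconjK x : cancel (lconj x) (lconj x^-1).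
Proof. by move=> y; rewrite -lconjM mulVg lconj1. Qed.

Lemma lconjKV x : cancel (lconj x^-1) (lconj x).
Proof. by move=> y; rewrite -lconjM mulgV lconj1. Qed.

End LeftConjugation.

Section LeftAction.
Variables (G H : groupType) (act : G -> H -> H).
Hypothesis hact : left_aut_action act.

Lemma left_actK g : cancel (act g) (act g^-1).
Proof. by move=> h; rewrite -(left_actM hact) mulVg (left_act1 hact). Qed.

Lemma left_actKV g : cancel (act g^-1) (act g).
Proof. by move=> h; rewrite -(left_actM hact) mulgV (left_act1 hact). Qed.

Lemma left_actV g h : act g h^-1 = (act g h)^-1.
Proof. exact/morph_inv/(left_act_mul hact). Qed.

Lemma left_act_lconj g h h' : act g (lconj h h') = lconj (act g h) (act g h').
Proof. by rewrite /lconj !(left_act_mul hact) left_actV. Qed.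

End LeftAction.

(** * Conjugation in the tensor product *)

Section Tensor.
Variables (G H : groupType) (aGH : G -> H -> H) (aHG : H -> G -> G).
Hypotheses (hGH : left_aut_action aGH) (hHG : left_aut_action aHG).
Hypothesis hcompat : compatible_actions aGH aHG.

Local Notation T := (nonabelian_tensor aGH aHG).
Local Notation "g '⊗' h" := (tensor aGH aHG g h) (at level 35).

(** Compatibility in the form of equivariance under the diagonal action of [g]. *)
Lemma act_lconjG g h g' : aHG (aGH g h) (lconj g g') = lconj g (aHG h g').
Proof. by rewrite hcompat.2 lconjK. Qed.

Lemma act_lconjH g h h' : aGH (aHG h g) (lconj h h') = lconj h (aGH g h').
Proof. by rewrite hcompat.1 lconjK. Qed.

Lemma tensor_ind (P : T -> Prop) :
    P 1 -> (forall g h t, P t -> P (g ⊗ h * t)) ->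
    (forall g h t, P t -> P ((g ⊗ h)^-1 * t)) ->
  forall t, P t.
Proof.
move=> P1 PM PV t; rewrite -(word_reprK t).
elim: (word_repr t) => [|[[g h] b] u IHu]; first exact: P1.
rewrite -cat1s -presented_mulE; case: b; last exact: PM.
have -> : word_class (tensor_rel aGH aHG) [:: (g, h, true)] = (g ⊗ h)^-1.
  exact/esym/presented_invE.
exact: PV.
Qed.

(** By the universal property: compatibility gives the relation in the first variable, and the one
    in the second telescopes. *)
Lemma tensor_lambda : exists2 lam : T -> G, {morph lam : x y / x * y} &
  forall g h, lam (g ⊗ h) = g * (aHG h g)^-1.
Proof.
pose f g h : G := g * (aHG h g)^-1.
case: (@tensor_lift _ _ aGH aHG _ f) => [g g' h|g h h'|lam [[lamM lamE] _]].
- rewrite /f act_lconjG (left_act_mul hHG) invgM /lconj !invgM invgK.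
  by rewrite !mulgA !mulgKV.
- rewrite /f -(left_actM hHG) /lconj mulgKV (left_actM hHG).
  by rewrite !mulgA mulgKV.
by exists lam.
Qed.

(* Compare the two expansions of [(a * p) ⊗ (b * q)]. *)
Lemma tensor_exchange a b p q :
  (lconj a (aHG b p) ⊗ aGH a (lconj b q)) * (a ⊗ b) =
  (a ⊗ b) * (aHG b (lconj a p) ⊗ lconj b (aGH a q)).
Proof.
have left_first : (a * p) ⊗ (b * q) = (lconj a p ⊗ aGH a b) *
    (lconj a (aHG b p) ⊗ aGH a (lconj b q)) *
    ((a ⊗ b) * (aHG b a ⊗ lconj b q)).
  rewrite [LHS]tensorMl [in X in X * _](left_act_mul hGH).
  rewrite [X in X * _]tensorMr [X in _ * X]tensorMr.
  by rewrite act_lconjG -(left_act_lconj hGH).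
have right_first : (a * p) ⊗ (b * q) = (lconj a p ⊗ aGH a b) * (a ⊗ b) *
    ((aHG b (lconj a p) ⊗ lconj b (aGH a q)) * (aHG b a ⊗ lconj b q)).
  rewrite [LHS]tensorMr [X in X * _]tensorMl [in X in _ * X](left_act_mul hHG).
  by rewrite [X in _ * X]tensorMl act_lconjH -(left_act_lconj hHG).
move: left_first; rewrite right_first -!mulgA => /mulgI.
by rewrite !mulgA => /mulIg.
Qed.

Lemma tensor_conj_symbol a b x y (l := a * (aHG b a)^-1) :
  (a ⊗ b) * (x ⊗ y) = (lconj l x ⊗ aGH l y) * (a ⊗ b).
Proof.
(* Here [p] and [q] are chosen so that the right-hand symbol of the exchange becomes [x ⊗ y]. *)
have := tensor_exchange a b (lconj a^-1 (aHG b^-1 x)) (aGH a^-1 (lconj b^-1 y)).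
rewrite lconjKV (left_actKV hHG) (left_actKV hGH) lconjKV => <-.
rewrite /l -(left_actV hHG) lconjM (left_actM hGH) hcompat.1.
by rewrite (left_act_lconj hHG) (left_actKV hHG).
Qed.

Section Lambda.
Variable lam : T -> G.
Hypothesis lamM : {morph lam : x y / x * y}.
Hypothesis lamE : forall g h, lam (g ⊗ h) = g * (aHG h g)^-1.

Lemma tensor_conj t x y :
  t * (x ⊗ y) = (lconj (lam t) x ⊗ aGH (lam t) y) * t.
Proof.
elim/tensor_ind: t x y => [|a b t IHt|a b t IHt] x y.
- by rewrite (morph_one lamM) lconj1 (left_act1 hGH) mul1g mulg1.
- rewrite -mulgA IHt mulgA tensor_conj_symbol -lamE -lconjM -(left_actM hGH).
  by rewrite -lamM mulgA.
rewrite -mulgA IHt; apply: (mulgI (a ⊗ b)).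
rewrite mulKVg !mulgA tensor_conj_symbol -lamE -lconjM -(left_actM hGH).
by rewrite -lamM mulKVg mulgK.
Qed.

(** When [lam z = 1] the diagonal action is trivial, so [z] commutes with every symbol. *)
Lemma lambda_ker_central z : lam z = 1 -> forall t, z * t = t * z.
Proof.
move=> z1; elim/tensor_ind => [|a b t IHt|a b t IHt].
- by rewrite mulg1 mul1g.
- by rewrite mulgA tensor_conj z1 lconj1 (left_act1 hGH) -!mulgA IHt.
rewrite -mulgA -IHt !mulgA; congr (_ * _).
apply: (mulIg (a ⊗ b)); rewrite mulgKV -mulgA tensor_conj z1 lconj1.
by rewrite (left_act1 hGH) mulKg.
Qed.

End Lambda.
End Tensor.

(** * Torsion in abelian images *)

Section FiniteTensor.
Variables (G H : finGroupType) (aGH : G -> H -> H) (aHG : H -> G -> G).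
Hypotheses (hGH : left_aut_action aGH) (hHG : left_aut_action aHG).

Local Notation T := (nonabelian_tensor aGH aHG).
Local Notation "g '⊗' h" := (tensor aGH aHG g h) (at level 35).

(* In an abelian image, summing [f (g ⊗ _)] over [H] and then over [G] turns
   each defining relation into a vanishing statement, as [^g _] and [^h _]
   only permute the terms. *)
Lemma tensor_abelian_torsion (A : zmodType) (f : T -> A) g h :
    (forall x y, f (x * y) = (f x + f y)%R) ->
  (f (g ⊗ h) *+ (#|G| * #|H|) = 0)%R.
Proof.
move=> fM; pose s g := (\sum_(h : H) f (g ⊗ h))%R.
have injG k : injective (aGH k) by apply: can_inj (left_actK hGH k).
have sM a b : s (a * b) = (s (lconj a b) + s a)%R.
  rewrite /s [X in (X + _)%R](reindex_inj (@injG a)) -big_split /=.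
  by apply: eq_bigr => x _; rewrite tensorMl fM.
have s_tors a : (s a *+ #|G| = 0)%R.
  apply: (addrI (\sum_b s b)%R); rewrite addr0.
  rewrite {1}(reindex_inj (can_inj (lconjK a))) -sumr_const -big_split /=.
  under eq_bigr do rewrite -sM.
  by rewrite [RHS](reindex_inj (mulgI a)).
have sE : s g = (f (g ⊗ h) *+ #|H| + s (aHG h g))%R.
  rewrite /s (reindex_inj (mulgI h)) /=.
  rewrite [X in (_ + X)%R](reindex_inj (can_inj (lconjK h))).
  rewrite -sumr_const -big_split /=.
  by apply: eq_bigr => x _; rewrite tensorMr fM.
(* Multiplying by [#|G|] kills both values of [s] and leaves only the symbol term. *)
move/(congr1 (fun x => x *+ #|G|)%R): sE.
by rewrite mulrnDl !s_tors addr0 mulnC mulrnA.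
Qed.

End FiniteTensor.

Theorem corollary4p9 (G H : finGroupType)
    (aGH : G -> H -> H) (aHG : H -> G -> G)
    (hGH : left_aut_action aGH) (hHG : left_aut_action aHG)
    (hcompat : compatible_actions aGH aHG) :
  finite_set [set: nonabelian_tensor aGH aHG]%classic.
Proof.
have [lam lamM lamE] := tensor_lambda hHG hcompat.
have conjE := tensor_conj hGH hHG hcompat lamM lamE.
pose f (x : G * H) := tensor aGH aHG x.1 x.2.
have /choice [o oP] : forall x, exists n, (0 < n) && (f x ^+ n == 1).
  move=> [g h]; have cardGH : 0 < #|G| * #|H|.
    by rewrite muln_gt0; apply/andP; split; apply/card_gt0P; exists 1.
  have [A phi phiM|n n_gt0 fn] := torsion_of_abelian_images lamM
    (lambda_ker_central hGH hHG hcompat lamM lamE) (t := f (g, h)) cardGH.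
    exact: tensor_abelian_torsion.
  by exists n; rewrite n_gt0 fn eqxx.
(* A common exponent for the finitely many symbols. *)
pose N := (\prod_x o x)%N.
have N_gt0 : 0 < N by apply: prodn_gt0 => x; case/andP: (oP x).
have fN x : f x ^+ N = 1.
  by rewrite /N (bigD1 x) //= expgM; case/andP: (oP x) => _ /eqP->;
     rewrite expg1n.
apply: (dietzmann (f := f) _ _ N_gt0 fN) => [[a b] [c d]|t].
  (* The conjugate of a symbol by the inverse of [f (a, b)] is again a symbol. *)
  exists (lconj (lam (f (a, b))^-1) c, aGH (lam (f (a, b))^-1) d).
  apply: (mulgI (f (a, b))^-1); rewrite mulKg mulgA.
  by rewrite -[f (c, d)]/(tensor aGH aHG c d) (conjE (f (a, b))^-1) mulgKV.
elim/tensor_ind: t => [|g h t [s ->]|g h t [s ->]].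
- by exists [::]; rewrite big_nil.
- by exists ((g, h) :: s); rewrite big_cons.
(* Only positive words are allowed, so the inverse of a symbol is written as its power [N.-1]. *)
exists (nseq N.-1 (g, h) ++ s); rewrite big_cat; congr (_ * _).
rewrite prodg_nseq; apply: (mulgI (f (g, h))).
by rewrite -expgS prednK // fN mulgV.
Qed.
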